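(* In the boundary-driven switching system with $\epsilon\in(0,1]$, $\gamma>0$, $N\ge2$, let $\vec\rho=(\rho_{L,0},\rho_{L,1},\rho_{R,0},\rho_{R,1})^T$. Then for all $x\in V$, $$\theta_0(x)=(\vec c_1\cdot\vec\rho)x+\vec c_2\cdot\vec\rho+\epsilon(\vec c_3\cdot\vec\rho)\alpha_1^x+\epsilon(\vec c_4\cdot\vec\rho)\alpha_2^x,\qquad \theta_1(x)=(\vec c_1\cdot\vec\rho)x+\vec c_2\cdot\vec\rho-(\vec c_3\cdot\vec\rho)\alpha_1^x-(\vec c_4\cdot\vec\rho)\alpha_2^x.$$
   Context: Boundary-driven switching system: fix $\sigma\in\{-1,0,1\}$, $N\in\mathbb N$, $V=\{1,\dots,N\}$, $\epsilon\in[0,1]$, $\gamma>0$, and reservoir parameters $\rho_{L,0},\rho_{L,1},\rho_{R,0},\rho_{R,1}\ge0$ (in $[0,1]$ if $\sigma=-1$). Configurations are $\eta=(\eta_0(x),\eta_1(x))_{x\in V}$ with values in $\{0,1\}$ if $\sigma=-1$ and in $\mathbb N_0$ if $\sigma\in\{0,1\}$. Writing $\delta_{(x,i)}$ for one particle at site $x$ in layer $i$, the continuous-time Markov chain has transitions: for $x\in\{1,\dots,N-1\}$, $i\in\{0,1\}$, $\eta\to\eta-\delta_{(x,i)}+\delta_{(x+1,i)}$ at rate $\epsilon^i\eta_i(x)(1+\sigma\eta_i(x+1))$ and $\eta\to\eta-\delta_{(x+1,i)}+\delta_{(x,i)}$ at rate $\epsilon^i\eta_i(x+1)(1+\sigma\eta_i(x))$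 ($\epsilon^0=1$); for $x\in V$, $\eta\to\eta-\delta_{(x,i)}+\delta_{(x,1-i)}$ at rate $\gamma\eta_i(x)(1+\sigma\eta_{1-i}(x))$; and for $i\in\{0,1\}$, $\eta\to\eta-\delta_{(1,i)}$ at rate $\eta_i(1)(1+\sigma\rho_{L,i})$, $\eta\to\eta+\delta_{(1,i)}$ at rate $\rho_{L,i}(1+\sigma\eta_i(1))$, $\eta\to\eta-\delta_{(N,i)}$ at rate $\eta_i(N)(1+\sigma\rho_{R,i})$, $\eta\to\eta+\delta_{(N,i)}$ at rate $\rho_{R,i}(1+\sigma\eta_i(N))$. This chain has a unique stationary distribution $\mu_{stat}$, and $\theta_i(x):=\mathbb E_{\mu_{stat}}[\eta_i(x)]$ is the stationary microscopic profile. Let $\alpha_1<\alpha_2$ be the two roots of $\epsilon\alpha^2-(\gamma(1+\epsilon)+2\epsilon)\alpha+\epsilon=0$, i.e. $\alpha_{1,2}=1+\frac\gamma2(1+\frac1\epsilon)\mp\sqrt{[1+\frac\gamma2(1+\frac1\epsilon)]^2-1}$. Let $$M_\epsilon=\begin{pmatrix}0&1&\epsilon&\epsilon\\ 1-\epsilon&1&(\epsilon-1)\alpha_1-\epsilon&(\epsilon-1)\alpha_2-\epsilon\\ N+1&1&\epsilon\alpha_1^{N+1}&\epsilon\alpha_2^{N+1}\\ N+\epsilon&1&-\alpha_1^N(\epsilon\alpha_1+1-\epsilon)&-\alpha_2^N(\epsilon\alpha_2+1-\epsilon)\end{pmatrix}$$ (an invertible matrix), and for $k\in\{1,2,3,4\}$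 let $\vec c_k=(M_\epsilon^{-1})^T\vec e_k\in\mathbb R^4$ (the transpose of the $k$-th row of $M_\epsilon^{-1}$). *)

(* Defs.v *)
From HB Require Import structures.
From mathcomp Require Import all_boot all_order all_algebra.
From mathcomp Require Import all_classical all_reals all_analysis.
Set Implicit Arguments. Unset Strict Implicit. Unset Printing Implicit Defensive.
Import Order.TTheory GRing.Theory Num.Theory.
Local Open Scope classical_set_scope.
Local Open Scope ring_scope.

(* Sites V = {1..N} are represented by 'I_N (index k <-> site k+1);
   layers {0,1} by bool (false <-> layer 0, true <-> layer 1).
   A configuration eta gives eta_i(x) = eta (x, i). *)
Definition Conf (N : nat) := {ffun 'I_N * bool -> nat}.

Definition addp N (eta : Conf N) (k : 'I_N * bool) : Conf N :=
  [ffun j => eta j + (j == k)]%N.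
Definition subp N (eta : Conf N) (k : 'I_N * bool) : Conf N :=
  [ffun j => eta j - (j == k)]%N.

Definition admissible N (s : int) (eta : Conf N) : bool :=
  (s != -1) || [forall k, eta k <= 1]%N.

Section Chain.
Variables (R : realType) (s : int) (N : nat) (eps gam : R)
          (rL0 rL1 rR0 rR1 : R).

Definition rhoL (b : bool) : R := if b then rL1 else rL0.
Definition rhoR (b : bool) : R := if b then rR1 else rR0.
Definition sg : R := s%:~R.

Definition nnpairs : seq ('I_N * 'I_N) :=
  [seq p <- [seq (x, y) | x <- enum 'I_N, y <- enum 'I_N] | (val p.2 == (val p.1).+1)%N].
Definition layers : seq bool := [:: false; true].

Definition jumpR (eta : Conf N) (p : 'I_N * 'I_N) (b : bool) : Conf N * R :=
  (addp (subp eta (p.1, b)) (p.2, b),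
   eps ^+ b * (eta (p.1, b))%:R * (1 + sg * (eta (p.2, b))%:R)).
Definition jumpL (eta : Conf N) (p : 'I_N * 'I_N) (b : bool) : Conf N * R :=
  (addp (subp eta (p.2, b)) (p.1, b),
   eps ^+ b * (eta (p.2, b))%:R * (1 + sg * (eta (p.1, b))%:R)).
Definition switch (eta : Conf N) (x : 'I_N) (b : bool) : Conf N * R :=
  (addp (subp eta (x, b)) (x, ~~ b),
   gam * (eta (x, b))%:R * (1 + sg * (eta (x, ~~ b))%:R)).

Definition leftsites : seq 'I_N := [seq x <- enum 'I_N | val x == 0%N].
Definition rightsites : seq 'I_N := [seq x <- enum 'I_N | val x == N.-1].

Definition remL (eta : Conf N) (x : 'I_N) (b : bool) : Conf N * R :=
  (subp eta (x, b), (eta (x, b))%:R * (1 + sg * rhoL b)).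
Definition creL (eta : Conf N) (x : 'I_N) (b : bool) : Conf N * R :=
  (addp eta (x, b), rhoL b * (1 + sg * (eta (x, b))%:R)).
Definition remR (eta : Conf N) (x : 'I_N) (b : bool) : Conf N * R :=
  (subp eta (x, b), (eta (x, b))%:R * (1 + sg * rhoR b)).
Definition creR (eta : Conf N) (x : 'I_N) (b : bool) : Conf N * R :=
  (addp eta (x, b), rhoR b * (1 + sg * (eta (x, b))%:R)).

Definition trans (eta : Conf N) : seq (Conf N * R) :=
  [seq jumpR eta p b | p <- nnpairs, b <- layers] ++
  [seq jumpL eta p b | p <- nnpairs, b <- layers] ++
  [seq switch eta x b | x <- enum 'I_N, b <- layers] ++
  [seq remL eta x b | x <- leftsites, b <- layers] ++
  [seq creL eta x b | x <- leftsites, b <- layers] ++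
  [seq remR eta x b | x <- rightsites, b <- layers] ++
  [seq creR eta x b | x <- rightsites, b <- layers].

Definition qrate (xi eta : Conf N) : R :=
  \sum_(m <- trans xi | m.1 == eta) m.2.
Definition outrate (eta : Conf N) : R :=
  \sum_(m <- trans eta | m.1 != eta) m.2.

Definition stationary (mu : Conf N -> R) : Prop :=
  [/\ (forall eta, 0 <= mu eta),
      (forall eta, ~~ admissible s eta -> mu eta = 0),
      (\esum_(eta in [set: Conf N]) (mu eta)%:E = 1%E) &
      (forall eta, admissible s eta ->
         \esum_(xi in [set xi | admissible s xi /\ xi <> eta])
            (mu xi * qrate xi eta)%:E = (mu eta * outrate eta)%:E)].

Definition theta (mu : Conf N -> R) (b : bool) (x : 'I_N) : \bar R :=
  \esum_(eta in [set: Conf N]) (mu eta * (eta (x, b))%:R)%:E.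

Definition abar : R := 1 + gam / 2 * (1 + eps^-1).
Definition alpha1 : R := abar - Num.sqrt (abar ^+ 2 - 1).
Definition alpha2 : R := abar + Num.sqrt (abar ^+ 2 - 1).

Definition Mrows : seq (seq R) :=
  [:: [:: 0; 1; eps; eps];
      [:: 1 - eps; 1; (eps - 1) * alpha1 - eps; (eps - 1) * alpha2 - eps];
      [:: N.+1%:R; 1; eps * alpha1 ^+ N.+1; eps * alpha2 ^+ N.+1];
      [:: N%:R + eps; 1; - (alpha1 ^+ N * (eps * alpha1 + 1 - eps));
                         - (alpha2 ^+ N * (eps * alpha2 + 1 - eps))]].

Definition Meps : 'M[R]_4 :=
  \matrix_(i < 4, j < 4) nth 0 (nth [::] Mrows i) j.

Definition rhovec : 'I_4 -> R := fun j => nth 0 [:: rL0; rL1; rR0; rR1] j.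

Definition cdot (k : nat) : R :=
  \sum_(j < 4) (invmx Meps) (inord k.-1) j * rhovec j.

End Chain.

(* Main.v *)
(* For a linear observable the quadratic terms of the rates cancel, so its drift is
   again affine in the occupation numbers and the stationary means solve a linear
   discrete boundary value problem.  Stationarity only gives zero mean drift to finitely
   supported observables.  The truncations min(h, n) - n of the concave Lyapunov function
   h = sum_x x (N + 1 - x) (eta_0(x) + eta_1(x)) bound the mean number of particles.
   Cutting a linear observable off at j particles then produces a flux of size at most
   C j a_j with a_j summable, so the mean drift, which converges, has limit 0 because
   the harmonic series diverges.  The explicit profile solves the boundary value problem
   by the choice of alpha_1, alpha_2 and of the four rows of M; the Dirichlet form gives
   uniqueness, and uniqueness for zero reservoirs gives the invertibility of M. *)
Require Import Defs.
From HB Require Import structures.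
From mathcomp Require Import all_boot all_order all_algebra.
From mathcomp Require Import all_classical all_reals all_analysis.
From mathcomp Require Import zify ring lra.
Set Implicit Arguments. Unset Strict Implicit. Unset Printing Implicit Defensive.
Import Order.TTheory GRing.Theory Num.Theory.
Import numFieldNormedType.Exports.
Local Open Scope classical_set_scope.
Local Open Scope ring_scope.

(** * Configurations, particle number and elementary moves *)

Lemma esum_seq (R : realType) (T : choiceType) (r : seq T) (P : pred T) (a : T -> R) :
  uniq r -> (forall i, P i -> 0 <= a i) -> (forall i, P i -> i \notin r -> a i = 0) ->
  \esum_(i in [set i | P i]) (a i)%:E = (\sum_(i <- r | P i) a i)%:E.
Proof.
move=> r_uniq a0 ar.
have fin : finite_set ([set i | P i] `&` [set` r]).
  by apply: finite_setIr; exact: finite_seq.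
transitivity (\esum_(i in [set i | P i] `&` [set` r]) (a i)%:E).
  rewrite esum_mkcondr; apply: eq_esum => i Pi.
  by rewrite mem_setE; case: ifPn => // /ar ->.
rewrite esum_fset //; last by move=> i /set_mem[Pi _]; rewrite lee_fin a0.
rewrite fsbig_mkcondl /= -fsbig_seq // -sumEFin [RHS]big_mkcond /=.
by apply: eq_bigr => i _; rewrite mem_setE.
Qed.

Definition tot N (eta : Conf N) : nat := (\sum_k eta k)%N.

(** [Conf N] is infinite, so the list is read off the finite type of functions into ['I_n.+1], which
    covers every configuration with at most [n] particles. *)
Definition upto N (n : nat) : seq (Conf N) :=
  [seq eta <- undup [seq ([ffun k => val (g k)] : Conf N)
                    | g : {ffun 'I_N * bool -> 'I_n.+1} <- enum {: {ffun 'I_N * bool -> 'I_n.+1}}]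
  | (tot eta <= n)%N].

Lemma conf_le_tot N (eta : Conf N) k : (eta k <= tot eta)%N.
Proof. by rewrite /tot (bigD1 k) //= leq_addr. Qed.

Lemma mem_upto N n (eta : Conf N) : (eta \in upto N n) = (tot eta <= n)%N.
Proof.
rewrite mem_filter mem_undup; case: leqP => //= le_n.
apply/mapP; exists [ffun k => inord (eta k)]; first by rewrite mem_enum.
apply/ffunP => k; rewrite !ffunE inordK // ltnS.
exact: leq_trans (conf_le_tot eta k) le_n.
Qed.

Lemma upto_uniq N n : uniq (upto N n).
Proof. by rewrite filter_uniq // undup_uniq. Qed.

Lemma subpK N (eta : Conf N) k : (0 < eta k)%N -> addp (subp eta k) k = eta.
Proof.
move=> pos; apply/ffunP => j; rewrite !ffunE subnK //.
by case: eqVneq => [->|//].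
Qed.

Lemma wtot_addp (R : pzSemiRingType) N (w : 'I_N * bool -> R) (eta : Conf N) k :
  \sum_j w j * (addp eta k j)%:R = \sum_j w j * (eta j)%:R + w k.
Proof.
under eq_bigr do rewrite ffunE natrD mulrDr.
rewrite big_split /=; congr (_ + _); rewrite (bigD1 k) //= eqxx mulr1 big1 ?addr0 //.
by move=> i /negPf ->; rewrite mulr0.
Qed.

Lemma wtot_subp (R : pzRingType) N (w : 'I_N * bool -> R) (eta : Conf N) k :
  (0 < eta k)%N ->
  \sum_j w j * (subp eta k j)%:R = \sum_j w j * (eta j)%:R - w k.
Proof. by move=> pos; rewrite -{2}(subpK pos) wtot_addp addrK. Qed.

Lemma tot_addp N (eta : Conf N) k : tot (addp eta k) = (tot eta).+1.
Proof.
rewrite /tot; under eq_bigr do rewrite ffunE.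
rewrite big_split /= -addn1; congr (_ + _)%N.
by rewrite (bigD1 k) //= eqxx big1 // => i /negPf ->.
Qed.

Lemma tot_subp N (eta : Conf N) k : (0 < eta k)%N -> (tot (subp eta k)).+1 = tot eta.
Proof. by move=> pos; rewrite -(tot_addp _ k) subpK. Qed.

(** * Discrete Laplacian and linear observables on the segment *)

Lemma sum_nnpairs (R : realType) N (F : 'I_N -> 'I_N -> R) :
  \sum_(p <- nnpairs N) F p.1 p.2 = \sum_x \sum_(y | val y == (val x).+1) F x y.
Proof.
rewrite /nnpairs big_filter big_mkcond big_allpairs big_enum /=.
by apply: eq_bigr => x _; rewrite big_enum /= -big_mkcond.
Qed.

(** Laplacian of the path with reflecting ends: a missing neighbour contributes 0. *)
Definition lap (R : realType) (N : nat) (w : nat -> R) (x : nat) : R :=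
  (if (x.+1 < N)%N then w x.+1 - w x else 0) - (if (0 < x)%N then w x - w x.-1 else 0).

Lemma sum_by_parts (R : realType) N (a : 'I_N -> R) (w : nat -> R) :
  \sum_x \sum_(y | val y == (val x).+1) (a x - a y) * (w y - w x) =
  \sum_x a x * lap N w x.
Proof.
under eq_bigr do (under eq_bigr do rewrite mulrBl; rewrite sumrB).
rewrite sumrB; under [X in _ = X]eq_bigr do rewrite mulrBr; rewrite sumrB.
congr (_ - _).
  apply: eq_bigr => x _; case: ifPn => xN.
    by rewrite (big_pred1 (Ordinal xN)) // => y; rewrite /= -val_eqE.
  rewrite mulr0 big_pred0 // => y; apply/negP => /eqP e.
  by move: xN; rewrite -e ltn_ord.
(* The second half is regrouped by the right end of each edge. *)
rewrite (exchange_big_dep xpredT) //=; apply: eq_bigr => y _.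
case: ifPn => y0.
  have yN : (y.-1 < N)%N by have := ltn_ord y; lia.
  rewrite (big_pred1 (Ordinal yN)) // => x; rewrite /= -val_eqE /=.
  by apply/eqP/eqP; lia.
rewrite mulr0 big_pred0 // => x; apply/negP => /eqP e.
by rewrite e in y0.
Qed.

Definition lin (R : realType) N (w : nat -> bool -> R) (eta : Conf N) : R :=
  \sum_(x : 'I_N) \sum_b w x b * (eta (x, b))%:R.

Lemma linE (R : realType) N (w : nat -> bool -> R) (eta : Conf N) :
  lin w eta = \sum_(k : 'I_N * bool) w k.1 k.2 * (eta k)%:R.
Proof. by rewrite /lin pair_bigA; apply: eq_bigr => -[]. Qed.

Lemma lin_addp (R : realType) N (w : nat -> bool -> R) (eta : Conf N) k :
  lin w (addp eta k) = lin w eta + w k.1 k.2.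
Proof. by rewrite !linE (wtot_addp (fun k : 'I_N * bool => w k.1 k.2)). Qed.

Lemma lin_subp (R : realType) N (w : nat -> bool -> R) (eta : Conf N) k :
  (0 < eta k)%N -> lin w (subp eta k) = lin w eta - w k.1 k.2.
Proof. by move=> pos; rewrite !linE (wtot_subp (fun k : 'I_N * bool => w k.1 k.2)). Qed.

Lemma lap_sym (R : realType) N (a w : nat -> R) :
  \sum_(x < N) a x * lap N w x = \sum_(x < N) w x * lap N a x.
Proof.
rewrite -(sum_by_parts (fun x : 'I_N => a x)) -(sum_by_parts (fun x : 'I_N => w x)).
by apply: eq_bigr => x _; apply: eq_bigr => y _; ring.
Qed.

Lemma lap_dirichlet (R : realType) N (d : nat -> R) :
  \sum_(x < N) d x * lap N d x = - \sum_(x < N) \sum_(y < N | val y == x.+1) (d y - d x) ^+ 2.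
Proof.
rewrite -(sum_by_parts (fun x : 'I_N => d x)) -sumrN.
by apply: eq_bigr => x _; rewrite -sumrN; apply: eq_bigr => y _; ring.
Qed.

(** * Sums along the exhaustion by particle number, and their limits *)

Lemma sum_upto_le N (R : realType) n m (F : Conf N -> R) : (n <= m)%N ->
  \sum_(xi <- upto N n) F xi = \sum_(xi <- upto N m | (tot xi <= n)%N) F xi.
Proof.
move=> nm; rewrite -[RHS]big_filter; apply: perm_big; apply: uniq_perm.
- exact: upto_uniq.
- by rewrite filter_uniq // upto_uniq.
- by move=> xi; rewrite mem_upto mem_filter mem_upto andb_idr // => /leq_trans -> .
Qed.

Lemma sum_upto_homo N (R : realType) (F : Conf N -> R) : (forall xi, 0 <= F xi) ->
  nondecreasing_seq (fun n => \sum_(xi <- upto N n) F xi).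
Proof.
move=> F0 n m nm; rewrite (sum_upto_le _ nm) [leRHS](bigID (fun xi => (tot xi <= n)%N)) /=.
by rewrite lerDl sumr_ge0.
Qed.

Lemma sum_upto_le_esum N (R : realType) (F : Conf N -> R) n : (forall xi, 0 <= F xi) ->
  ((\sum_(xi <- upto N n) F xi)%:E <= \esum_(xi in [set: Conf N]) (F xi)%:E)%E.
Proof.
move=> F0; apply: esum_ge; exists [set` upto N n]; first by split; [exact: finite_seq|].
by rewrite -fsbig_seq ?upto_uniq // sumEFin.
Qed.

Lemma sum_upto_cvg N (R : realType) (F : Conf N -> R) C : (forall xi, 0 <= F xi) ->
  (forall n, \sum_(xi <- upto N n) F xi <= C) ->
  exists2 T, (fun n => \sum_(xi <- upto N n) F xi) @ \oo --> T &
    \esum_(xi in [set: Conf N]) (F xi)%:E = T%:E.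
Proof.
move=> F0 FC; pose u n := \sum_(xi <- upto N n) F xi.
have u_homo : nondecreasing_seq u by exact: sum_upto_homo.
have u_cvg : cvgn u.
  by apply: nondecreasing_is_cvgn => //; exists C => _ [n _ <-]; exact: FC.
have u_le n : u n <= limn u by exact: nondecreasing_cvgn_le.
exists (limn u); first exact: u_cvg.
apply/eqP; rewrite eq_le; apply/andP; split.
  apply: ge_ereal_sup => _ [X [finX _] <-].
  rewrite fsbig_finite // sumEFin lee_fin.
  (* A finite set of configurations lies in [upto N n] for its largest particle number [n]. *)
  set r := finmap.enum_fset _; pose n := (\max_(xi <- r) tot xi)%N.
  have r_uniq : uniq r by exact: finmap.fset_uniq.
  apply: le_trans (u_le n); rewrite /u.
  rewrite [leRHS](bigID (fun xi => xi \in r)) /= -[leLHS]addr0 lerD ?sumr_ge0 //.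
  rewrite -[leRHS]big_filter le_eqVlt; apply/orP; left; apply/eqP; apply: perm_big.
  apply: uniq_perm => //; first by rewrite filter_uniq // upto_uniq.
  move=> xi; rewrite mem_filter mem_upto; case: (boolP (xi \in _)) => //= xiX.
  by apply/esym; rewrite /n; apply: leq_bigmax_seq.
have := fun n => sum_upto_le_esum n F0.
case: (\esum_(xi in _) _)%E => [l ul| _|/(_ 0%N)//]; last by rewrite leey.
by rewrite lee_fin; apply: limr_le => //; apply: nearW => n; have := ul n; rewrite lee_fin.
Qed.

(** If [l] were nonzero, [a i] would eventually exceed a constant multiple of [1 / (i + 1)], and the
    bounded sums of [a] would bound the harmonic series. *)
Lemma lim_eq0_of_harmonic (R : realType) (u a : nat -> R) (l C : R) :
  u @ \oo --> l -> (forall i, `|u i| <= i.+1%:R * a i) ->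
  (forall n, \sum_(i < n) a i <= C) -> l = 0.
Proof.
move=> ul ua aC; apply/eqP; apply/negPn/negP => l0.
have c0 : 0 < `|l| / 2 by rewrite divr_gt0 // normr_gt0.
have [n0 _ hn0] : \forall i \near \oo, `|l| / 2 < `|u i|.
  by apply: (cvgr_gt `|l|); [exact: cvg_norm|rewrite ltr_pdivrMr // ltr_pMr ?normr_gt0 // ltr1n].
have a0 i : 0 <= a i.
  by rewrite -(pmulr_rge0 _ (ltr0Sn R i)) (le_trans _ (ua i)).
have ha i : harmonic i <= (`|l| / 2)^-1 * a i + (if (i < n0)%N then 1 else 0) :> R.
  case: ltnP => i0 /=.
    apply: ler_wpDl; first by rewrite mulr_ge0 // invr_ge0 ltW.
    by rewrite invf_le1 // ler1n.
  rewrite addr0 ler_pdivlMl // ler_pdivrMr // [leRHS]mulrC.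
  exact: le_trans (ltW (hn0 i i0)) (ua i).
apply: (@dvg_harmonic R); apply: nondecreasing_is_cvgn.
  by apply/nondecreasing_series => i _ _; exact: harmonic_ge0.
exists ((`|l| / 2)^-1 * C + n0%:R) => _ [n _ <-].
rewrite /series /= big_mkord.
apply: (@le_trans _ _ (\sum_(i < n) ((`|l| / 2)^-1 * a i + (if (i < n0)%N then 1 else 0)))).
  by apply: ler_sum => i _; exact: ha.
rewrite big_split /= -mulr_sumr; apply: lerD; first by rewrite ler_wpM2l ?invr_ge0 ?(ltW c0) //; exact: aC.
suff -> : \sum_(i < n) (if (i < n0)%N then 1 else 0) = (minn n n0)%:R :> R.
  by rewrite ler_nat geq_minr.
elim: n => [|n IHn]; first by rewrite big_ord0 min0n.
rewrite big_ord_recr /= IHn; case: ltnP => nn0; last by rewrite addr0; congr _%:R; lia.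
by rewrite natr1; congr _%:R; lia.
Qed.

(** * The linear boundary value problem: symmetry and definiteness *)

Section Profile.
Variables (R : realType) (N : nat) (eps gam rL0 rL1 rR0 rR1 : R).
Hypotheses (eps0 : 0 < eps) (gam0 : 0 < gam) (N2 : (2 <= N)%N).

Local Notation rhoL := (@rhoL R rL0 rL1).
Local Notation rhoR := (@rhoR R rR0 rR1).

Definition inflow (x : nat) (b : bool) : R :=
  (x == 0%N)%:R * rhoL b + (x == N.-1)%:R * rhoR b.

(** Generator of a single walker: hops with reflecting ends, switching of layers, and killing at
    rate 1 at each end site. *)
Definition kappa (w : nat -> bool -> R) (x : nat) (b : bool) : R :=
  eps ^+ b * lap N (w^~ b) x + gam * (w x (~~ b) - w x b)
  - ((x == 0%N)%:R + (x == N.-1)%:R) * w x b.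

Let edge (x : nat) : R := (x == 0%N)%:R + (x == N.-1)%:R.

(** Separates the Laplacians of the two layers from a part that is diagonal in the site; symmetry
    and definiteness can then be checked term by term. *)
Lemma kappa_form (a w : nat -> bool -> R) : \sum_(x < N) \sum_b a x b * kappa w x b =
  eps * \sum_(x < N) a x true * lap N (w^~ true) x + \sum_(x < N) a x false * lap N (w^~ false) x
  - \sum_(x < N) (gam * (a x true - a x false) * (w x true - w x false)
     + edge x * (a x true * w x true + a x false * w x false)).
Proof.
rewrite mulr_sumr -big_split -sumrB; apply: eq_bigr => x _ /=.
by rewrite big_bool /= /kappa -/(edge x) /=; ring.
Qed.

Lemma kappa_sym (a w : nat -> bool -> R) :
  \sum_(x < N) \sum_b a x b * kappa w x b = \sum_(x < N) \sum_b w x b * kappa a x b.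
Proof.
rewrite !kappa_form (lap_sym _ (a^~ true)) (lap_sym _ (a^~ false)); congr (_ - _).
by apply: eq_bigr => x _; ring.
Qed.

(* The Dirichlet form vanishes only on constants, and the boundary sites carry killing. *)
Lemma kappa_definite (d : nat -> bool -> R) :
  \sum_(x < N) \sum_b d x b * kappa d x b = 0 ->
  forall x b, (x < N)%N -> d x b = 0.
Proof.
rewrite kappa_form !lap_dirichlet.
set A := \sum_(x < N) _; set B := \sum_(x < N) _; set C := \sum_(x < N) _ => form0.
have A0 : 0 <= A by apply: sumr_ge0 => x _; apply: sumr_ge0 => y _; exact: sqr_ge0.
have B0 : 0 <= B by apply: sumr_ge0 => x _; apply: sumr_ge0 => y _; exact: sqr_ge0.
have ctermE (x : 'I_N) : 0 <= gam * (d x true - d x false) * (d x true - d x false)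
     + edge x * (d x true * d x true + d x false * d x false).
  have edge0 : 0 <= edge x by rewrite /edge addr_ge0.
  rewrite -mulrA -!expr2; apply: addr_ge0; first by rewrite mulr_ge0 ?sqr_ge0 // ltW.
  by rewrite mulr_ge0 // addr_ge0 // sqr_ge0.
have C0 : 0 <= C by apply: sumr_ge0 => x _; exact: ctermE.
have eA0 : 0 <= eps * A by rewrite mulr_ge0 // ltW.
have [eA B_0 C_0] : [/\ eps * A = 0, B = 0 & C = 0].
  move: form0 eA0 B0 C0; rewrite mulrN; move: (eps * A) B C => p q r e p0 q0 r0.
  by split; lra.
have A_0 : A = 0 by move/eqP: eA; rewrite mulf_eq0 (gt_eqF eps0) => /eqP.
have step (u : nat -> R) : \sum_(x < N) \sum_(y < N | val y == x.+1) (u y - u x) ^+ 2 = 0 ->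
    forall x, (x.+1 < N)%N -> u x.+1 = u x.
  move=> u0 x xN; pose i := Ordinal (ltnW xN); pose j := Ordinal xN.
  have := psumr_eq0P (fun x _ => sumr_ge0 _ (fun y _ => sqr_ge0 _)) u0.
  move=> /(_ i isT) /= /(psumr_eq0P (fun y _ => sqr_ge0 _)) /(_ j).
  by rewrite eqxx => /(_ isT) /eqP; rewrite sqrf_eq0 subr_eq0 => /eqP.
move=> x b xN; have N0 : (0 < N)%N by exact: leq_trans xN.
(* The killing weight [edge 0] is at least 1, so both layers vanish at the left end; [step] then
   carries the zero along each layer. *)
have d0 c : d 0%N c = 0.
  have := psumr_eq0P (fun x _ => ctermE x) C_0 => /(_ (Ordinal N0) isT) /=.
  have e1 : 1 <= edge 0 by rewrite /edge eqxx lerDl.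
  have := sqr_ge0 (d 0%N true); have := sqr_ge0 (d 0%N false).
  have := mulr_ge0 (ltW gam0) (sqr_ge0 (d 0%N true - d 0%N false)).
  rewrite !expr2 -mulrA; set p := gam * _; set q := d 0%N true * _; set r := d 0%N false * _.
  move=> p0 r0 q0 e.
  have : 0 <= (edge 0 - 1) * (q + r) by rewrite mulr_ge0 ?subr_ge0 ?addr_ge0.
  move=> f; have [q_0 r_0] : q = 0 /\ r = 0 by split; lra.
  by case: c; [move/eqP: q_0|move/eqP: r_0]; rewrite mulf_eq0 orbb => /eqP.
elim: x xN => [//|x IHx] xN; rewrite -(IHx (ltnW xN)).
by case: b {IHx}; [exact: (step (d^~ true))|exact: (step (d^~ false))].
Qed.

(** * The roots of the characteristic equation and the explicit profile *)

Local Notation a1 := (alpha1 eps gam).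
Local Notation a2 := (alpha2 eps gam).

Lemma abar_gt1 : 1 < abar eps gam.
Proof. by rewrite /abar ltrDl mulr_gt0 ?divr_gt0 // addr_gt0 // invr_gt0. Qed.

Lemma discr_gt0 : 0 < abar eps gam ^+ 2 - 1.
Proof. by rewrite subr_gt0 expr_gt1 ?abar_gt1 // ltW // (lt_trans ltr01 abar_gt1). Qed.

Lemma alpha_neq : a2 - a1 != 0.
Proof.
have h : 0 < Num.sqrt (abar eps gam ^+ 2 - 1) by rewrite sqrtr_gt0 discr_gt0.
by rewrite gt_eqF // /alpha1 /alpha2; lra.
Qed.

Lemma abarE : 2 * eps * abar eps gam = gam * (1 + eps) + 2 * eps.
Proof. by rewrite /abar; field; rewrite gt_eqF. Qed.

(** Completing the square: the middle coefficient is [2 * eps * abar], by [abarE]. *)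
Lemma alpha_root a : a = a1 \/ a = a2 ->
  eps * a ^+ 2 - (gam * (1 + eps) + 2 * eps) * a + eps = 0.
Proof.
move=> ha; rewrite -abarE.
have : (a - abar eps gam) ^+ 2 = abar eps gam ^+ 2 - 1.
  rewrite -(sqr_sqrtr (ltW discr_gt0)).
  by case: ha => ->; rewrite /alpha1 /alpha2; ring.
move=> e; rewrite [LHS](_ : _ = eps * ((a - abar eps gam) ^+ 2 - (abar eps gam ^+ 2 - 1))).
  by rewrite e subrr mulr0.
by ring.
Qed.

Lemma alpha_neq0 a : a = a1 \/ a = a2 -> a != 0.
Proof.
move=> /alpha_root; apply: contra_eq_neq => ->.
by rewrite expr0n mulr0 mulr0 subr0 add0r gt_eqF.
Qed.

(* [X = 0] and [X = N + 1] are the ghost sites of the reservoirs. *)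
Definition profile (v : 'cV[R]_4) (X : nat) (b : bool) : R :=
  v (inord 0) 0 * X%:R + v (inord 1) 0 +
  (if b then -1 else eps) * (v (inord 2) 0 * a1 ^+ X + v (inord 3) 0 * a2 ^+ X).

(** The affine part is harmonic and common to both layers. On a mode [a ^+ X] the left side is, up
    to sign, a multiple of the quadratic with roots [a1] and [a2]. *)
Lemma profile_bulk v X (b : bool) :
  eps ^+ b * (profile v X.+2 b - 2 * profile v X.+1 b + profile v X b)
  + gam * (profile v X.+1 (~~ b) - profile v X.+1 b) = 0.
Proof.
have r1 := alpha_root (or_introl (erefl a1)).
have r2 := alpha_root (or_intror (erefl a2)).
rewrite /profile -(natr1 X.+1) -(natr1 X) !exprS.
set c3 := v (inord 2) 0; set c4 := v (inord 3) 0.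
pose q a := eps * a ^+ 2 - (gam * (1 + eps) + 2 * eps) * a + eps.
have z : c3 * a1 ^+ X * q a1 + c4 * a2 ^+ X * q a2 = 0 by rewrite /q r1 r2 !mulr0 addr0.
case: b; rewrite /= ?expr1 ?expr0.
- by rewrite -[RHS](oppr0) -z /q; ring.
- by rewrite -z /q; ring.
Qed.

(** In the interior this is the bulk equation. At an end site the reflecting [lap] lacks the
    difference towards the ghost site; subtracting the bulk equation leaves a mixture of the end
    value and the ghost value. *)
Lemma kappa_profile v x (b : bool) : (x < N)%N ->
  kappa (fun x => profile v x.+1) x b =
  - ((x == 0%N)%:R * ((1 - eps ^+ b) * profile v 1 b + eps ^+ b * profile v 0 b)
    + (x == N.-1)%:R * ((1 - eps ^+ b) * profile v N b + eps ^+ b * profile v N.+1 b)).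
Proof.
move=> xN; have := profile_bulk v x b; rewrite /kappa /lap.
set g := gam * _ => bulk.
have -> : g = - (eps ^+ b * (profile v x.+2 b - 2 * profile v x.+1 b + profile v x b)).
  by apply/eqP; rewrite -addr_eq0 addrC bulk.
case: x xN {g bulk} => [|x] xN /=.
  have -> : (0 == N.-1)%N = false by apply/eqP; lia.
  by rewrite N2 /= !mulr0n mulr1n; ring.
case: ifPn => xN'.
  have -> : (x.+1 == N.-1)%N = false by apply/eqP; lia.
  by rewrite /= !mulr0n; ring.
have -> : N = x.+2 by lia.
by rewrite /= eqxx /= !mulr0n mulr1n; ring.
Qed.

(** * The matrix M and the solution of the boundary value problem *)

Local Notation M := (@Meps R N eps gam).

Lemma Meps_mulE (v : 'cV[R]_4) (i : 'I_4) :
  (M *m v) i 0 = \sum_(j < 4) nth 0 (nth [::] (Mrows N eps gam) i) j * v (inord j) 0.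
Proof. by rewrite mxE; apply: eq_bigr => j _; rewrite mxE inord_val. Qed.

(** The rows of M are the boundary mixtures: row [b] belongs to layer [b] at the left end and row
    [b.+2] at the right end, in the order of [rhovec]. *)
Lemma Meps_profile (v : 'cV[R]_4) (b : bool) :
  (1 - eps ^+ b) * profile v 1 b + eps ^+ b * profile v 0 b = (M *m v) (inord b) 0 /\
  (1 - eps ^+ b) * profile v N b + eps ^+ b * profile v N.+1 b = (M *m v) (inord b.+2) 0.
Proof.
rewrite !Meps_mulE !big_ord_recr !big_ord0 /= !inordK; try by case: (b).
rewrite /profile -(natr1 N) !exprS expr0.
by case: b; rewrite /= ?expr1 ?expr0 ?mulr0n ?mulr1n; split; rewrite ?exprS -?(natr1 N); ring.
Qed.

Lemma kappa_profile_mx v x (b : bool) : (x < N)%N ->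
  kappa (fun x => profile v x.+1) x b =
  - ((x == 0%N)%:R * (M *m v) (inord b) 0 + (x == N.-1)%:R * (M *m v) (inord b.+2) 0).
Proof. by move=> xN; rewrite kappa_profile //; have [-> ->] := Meps_profile v b. Qed.

(** Two sites suffice. The difference of the layers isolates the exponential modes, which are
    independent because the roots are distinct and nonzero; an affine function with two zeros
    remains. *)
Lemma profile_eq0 v : (forall x b, (x < N)%N -> profile v x.+1 b = 0) -> v = 0.
Proof.
move=> z; have z1 b := z 0%N b (ltnW N2); have z2 b := z 1%N b N2.
move: (z1 true) (z1 false) (z2 true) (z2 false); rewrite /profile !expr1.
set c1 := v (inord 0) 0; set c2 := v (inord 1) 0.
set c3 := v (inord 2) 0; set c4 := v (inord 3) 0 => e1 e2 e3 e4.
have eps1 : 1 + eps != 0 by rewrite gt_eqF // addr_gt0.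
have f1 : c3 * a1 + c4 * a2 = 0.
  by apply: (mulfI eps1); rewrite mulr0 -[RHS](subrr (0 : R)) -{1}e2 -e1; ring.
have f2 : c3 * a1 ^+ 2 + c4 * a2 ^+ 2 = 0.
  by apply: (mulfI eps1); rewrite mulr0 -[RHS](subrr (0 : R)) -{1}e4 -e3; ring.
have n1 : a1 != 0 by apply: alpha_neq0; left.
have n2 : a2 != 0 by apply: alpha_neq0; right.
have c40 : c4 = 0.
  apply: (mulIf n2); apply: (mulIf alpha_neq); rewrite !mul0r.
  have -> : c4 * a2 * (a2 - a1) = (c3 * a1 ^+ 2 + c4 * a2 ^+ 2) - a1 * (c3 * a1 + c4 * a2) by ring.
  by rewrite f1 f2 mulr0 subrr.
have c30 : c3 = 0 by apply: (mulIf n1); move: f1; rewrite c40 !mul0r addr0.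
move: e1 e3; rewrite c30 c40 !mul0r addr0 mulr0 !addr0 => e1 e3.
have c10 : c1 = 0 by rewrite -[RHS](subrr (0 : R)) -{1}e3 -e1; ring.
have c20 : c2 = 0 by move: e1; rewrite c10 mul0r add0r.
apply/matrixP => i j; rewrite mxE (ord1 j) -(inord_val i).
by case: i => -[|[|[|[|//]]]].
Qed.

(** A kernel vector yields a profile annihilated by [kappa], which vanishes by definiteness. *)
Lemma Meps_unit : M \in unitmx.
Proof.
rewrite -unitmx_tr -row_free_unit; apply: inj_row_free => u uM.
have Mu : M *m u^T = 0 by rewrite -[M]trmxK -trmx_mul uM trmx0.
apply: trmx_inj; rewrite trmx0; apply: profile_eq0.
apply: (kappa_definite (d := fun x => profile u^T x.+1)).
rewrite big1 // => x _; rewrite big1 // => b _.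
by rewrite kappa_profile_mx // Mu !mxE !mulr0 addr0 oppr0 mulr0.
Qed.

(** The weak equation is tested with the error [d] itself. Symmetry moves [kappa] from [d] onto the
    profile, where it gives minus the inflow, so the form of [d] vanishes. *)
Lemma mean_profile (T : nat -> bool -> R) :
  (forall w : nat -> bool -> R,
    \sum_(x : 'I_N) \sum_b (w x b * inflow x b + kappa w x b * T x b) = 0) ->
  forall x b, (x < N)%N ->
  T x b = profile (invmx M *m \col_j rhovec rL0 rL1 rR0 rR1 j) x.+1 b.
Proof.
move=> hT; set v := invmx M *m _; pose p x := profile v x.+1.
have Mv : M *m v = \col_j rhovec rL0 rL1 rR0 rR1 j by rewrite mulKVmx // Meps_unit.
have kp (x : 'I_N) b : kappa p x b = - inflow x b.
  by rewrite /p kappa_profile_mx // Mv !mxE /inflow /rhovec !inordK; case: b.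
pose d x b := T x b - p x b.
suff d0 : \sum_(x < N) \sum_b d x b * kappa d x b = 0.
  by move=> x b xN; apply/eqP; rewrite -subr_eq0; apply/eqP; exact: (kappa_definite d0).
rewrite -[RHS](hT d).
transitivity (\sum_(x < N) \sum_b T x b * kappa d x b - \sum_(x < N) \sum_b p x b * kappa d x b).
  by rewrite -sumrB; apply: eq_bigr => y _; rewrite -sumrB; apply: eq_bigr => c _; exact: mulrBl.
rewrite (kappa_sym p) -sumrB; apply: eq_bigr => y _; rewrite -sumrB; apply: eq_bigr => c _.
by rewrite kp; ring.
Qed.

End Profile.

(** * The moves of the chain and bounds on their rates *)

Section Generator.
Variables (R : realType) (s : int) (N : nat) (eps gam rL0 rL1 rR0 rR1 : R).
Hypothesis s_val : [|| s == -1, s == 0 | s == 1].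
Hypothesis eps0 : 0 < eps.
Hypothesis gam0 : 0 < gam.
Hypotheses (rL00 : 0 <= rL0) (rL10 : 0 <= rL1) (rR00 : 0 <= rR0) (rR10 : 0 <= rR1).
Hypothesis r_le1 : s = -1 -> [/\ rL0 <= 1, rL1 <= 1, rR0 <= 1 & rR1 <= 1].

Local Notation trans := (@trans R s N eps gam rL0 rL1 rR0 rR1).
Local Notation sg := (@sg R s).
Local Notation rhoL := (@rhoL R rL0 rL1).
Local Notation rhoR := (@rhoR R rR0 rR1).
Local Notation inflow := (inflow N rL0 rL1 rR0 rR1).
Local Notation kappa := (kappa N eps gam).
Local Notation adm := (@admissible N s).
Local Notation rsum := (rL0 + rL1 + rR0 + rR1).
Implicit Types (eta xi : Conf N) (m : Conf N * R) (k l : 'I_N * bool).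

(** Jumps and switches are both [Hop]. [Rem] and [Cre] forget side and layer and keep only the
    bounds on the reservoir parameter that control sign and growth of the rates. *)
Variant move_spec xi : Conf N * R -> Prop :=
| Hop k l r of k != l & 0 <= r :
    move_spec xi (addp (subp xi k) l, r * (xi k)%:R * (1 + sg * (xi l)%:R))
| Rem k r of 0 <= r & r <= rsum & (s = -1 -> r <= 1) :
    move_spec xi (subp xi k, (xi k)%:R * (1 + sg * r))
| Cre k r of 0 <= r & r <= rsum :
    move_spec xi (addp xi k, r * (1 + sg * (xi k)%:R)).

Lemma moveP xi m : m \in trans xi -> move_spec xi m.
Proof.
have rL b : [/\ 0 <= rhoL b, rhoL b <= rsum & (s = -1 -> rhoL b <= 1)].
  split; [by case: b | by move: rL00 rL10 rR00 rR10; case: b => /=; lra |].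
  by move=> /r_le1 []; case: b.
have rR b : [/\ 0 <= rhoR b, rhoR b <= rsum & (s = -1 -> rhoR b <= 1)].
  split; [by case: b | by move: rL00 rL10 rR00 rR10; case: b => /=; lra |].
  by move=> /r_le1 []; case: b.
have nn p : p \in nnpairs N -> p.1 != p.2.
  rewrite mem_filter => /andP[/eqP e _]; apply: contra_eq_neq e => ->.
  by rewrite neq_ltn leqnn.
have pw b : 0 <= eps ^+ b by rewrite exprn_ge0 // ltW.
rewrite /Defs.trans !mem_cat => /or4P[|||/or4P[]];
  move=> /allpairsP[[p b] /= [ip ib ->]].
- by apply: Hop => //; apply: contra (nn _ ip) => /eqP[->].
- by apply: Hop => //; apply: contra (nn _ ip) => /eqP[->].
- apply: Hop; last exact: ltW.
  by apply/eqP => -[]; case: (b).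
- by have [? ? ?] := rL b; apply: Rem.
- by have [? ? ?] := rL b; apply: Cre.
- by have [? ? ?] := rR b; apply: Rem.
- by have [? ? ?] := rR b; apply: Cre.
Qed.

Lemma sgE : [\/ s = -1 /\ sg = -1, s = 0 /\ sg = 0 | s = 1 /\ sg = 1].
Proof.
rewrite /Defs.sg; case/or3P: s_val => /eqP ->; [apply: Or31|apply: Or32|apply: Or33];
  by split.
Qed.

Lemma adm_le1 xi k : adm xi -> s = -1 -> (xi k <= 1)%N.
Proof. by rewrite /admissible => /[swap] -> /forallP. Qed.

Lemma adm_rate_ge0 xi k : adm xi -> 0 <= 1 + sg * (xi k)%:R.
Proof.
move=> ax; have xk : 0 <= (xi k)%:R :> R by [].
case: sgE => -[es ->]; [|by lra|by lra].
have : (xi k)%:R <= 1 :> R by rewrite (ler_nat _ _ 1) adm_le1.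
by lra.
Qed.

Lemma sg_r_ge0 r : 0 <= r -> (s = -1 -> r <= 1) -> 0 <= 1 + sg * r.
Proof. by move=> r0 r1; case: sgE => -[es ->]; [have := r1 es| |]; lra. Qed.

Lemma adm_addp xi k : adm xi -> 1 + sg * (xi k)%:R != 0 -> adm (addp xi k).
Proof.
move=> ax; rewrite /admissible; case: (eqVneq s (-1)) => //= es.
case: sgE => -[]; rewrite es // => _ -> nz.
apply/forallP => j; rewrite ffunE; case: eqVneq => [->|_]; last by rewrite addn0 adm_le1.
(* Under exclusion the factor vanishes at an occupied site, so a nonzero factor means an empty
   one. *)
have := adm_le1 k ax es; case: (xi k) nz => [|[|]] //.
by rewrite mulN1r subrr eqxx.
Qed.

Lemma adm_subp xi k : adm xi -> adm (subp xi k).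
Proof.
rewrite /admissible; case: (eqVneq s (-1)) => //= es /forallP h.
apply/forallP => j; rewrite ffunE; exact: leq_trans (leq_subr _ _) (h j).
Qed.

Lemma move_rate_ge0 xi m : adm xi -> m \in trans xi -> 0 <= m.2.
Proof.
move=> ax /moveP [k l r _ r0|k r r0 _ r1|k r r0 _] /=.
- by rewrite mulr_ge0 ?mulr_ge0 ?adm_rate_ge0.
- by rewrite mulr_ge0 ?sg_r_ge0.
- by rewrite mulr_ge0 ?adm_rate_ge0.
Qed.

Lemma move_adm xi m : adm xi -> m \in trans xi -> m.2 != 0 -> adm m.1.
Proof.
move=> ax /moveP [k l r kl r0|k r r0 _ r1|k r r0 _] /=.
- rewrite !mulf_eq0 !negb_or => /andP[_ nz]; apply: adm_addp; first exact: adm_subp.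
  by rewrite ffunE (eq_sym l) (negPf kl) subn0.
- by move=> _; apply: adm_subp.
- by rewrite mulf_eq0 negb_or => /andP[_ nz]; apply: adm_addp.
Qed.

Lemma move_tot xi m : m \in trans xi -> m.2 != 0 ->
  (tot m.1 <= (tot xi).+1)%N /\ (tot xi <= (tot m.1).+1)%N.
Proof.
have pos (n : nat) : n%:R != 0 :> R -> (0 < n)%N.
  by case: n => //; rewrite eqxx.
move=> /moveP [k l r kl r0|k r r0 _ r1|k r r0 _] /=.
- rewrite !mulf_eq0 !negb_or => /andP[/andP[_ /pos xk] _].
  by rewrite tot_addp tot_subp.
- by rewrite mulf_eq0 negb_or => /andP[/pos xk _]; rewrite -(tot_subp xk); split; lia.
- by move=> _; rewrite tot_addp; split; lia.
Qed.

(** Hop rates can grow quadratically, but hops preserve the particle number. Only reservoir moves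
    change it, and their rates are at most linear; this makes the cut-off by particle number
    effective. *)
Lemma move_bulk_or_linear xi m : m \in trans xi ->
  [\/ m.2 = 0, tot m.1 = tot xi | m.2 <= (1 + rsum) * (1 + (tot xi)%:R)].
Proof.
have sg1 : sg <= 1 by case: sgE => -[_ ->]; lra.
have pos (n : nat) : n%:R != 0 :> R -> (0 < n)%N.
  by case: n => //; rewrite eqxx.
have le k : (xi k)%:R <= (tot xi)%:R :> R by rewrite ler_nat conf_le_tot.
have xk0 k : 0 <= (xi k)%:R :> R by [].
move=> /moveP [k l r kl r0|k r r0 rs r1|k r r0 rs] /=.
- have [->|xk] := eqVneq (xi k) 0%N; first by apply: Or31; rewrite mulr0 mul0r.
  by apply: Or32; rewrite tot_addp tot_subp // lt0n.
- apply: Or33; rewrite mulrC ler_pM ?sg_r_ge0 //; last by have := le k; lra.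
  by rewrite lerD2l (le_trans _ rs) // ler_piMl.
- apply: Or33; apply: (@le_trans _ _ (r * (1 + (xi k)%:R))).
    by rewrite ler_wpM2l // lerD2l ler_piMl.
  by rewrite ler_pM ?addr_ge0 ?lerD2l //; lra.
Qed.

(** * The generator and stationarity against finitely supported observables *)

Definition gen (f : Conf N -> R) xi : R := \sum_(m <- trans xi) m.2 * (f m.1 - f xi).

Local Notation qrate := (@qrate R s N eps gam rL0 rL1 rR0 rR1).
Local Notation outrate := (@outrate R s N eps gam rL0 rL1 rR0 rR1).

(** Regroups the list of moves by target, since several moves may share one; a move back to [xi]
    contributes 0. *)
Lemma genE (r : seq (Conf N)) f xi : uniq r -> (forall eta, eta \notin r -> f eta = 0) ->
  gen f xi = \sum_(eta <- r | eta != xi) qrate xi eta * f eta - outrate xi * f xi.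
Proof.
move=> r_uniq fr.
have -> : gen f xi = \sum_(m <- trans xi | m.1 != xi) m.2 * f m.1 - outrate xi * f xi.
  rewrite /gen (bigID (fun m => m.1 == xi)) /= big1 ?add0r; last first.
    by move=> m /eqP ->; rewrite subrr mulr0.
  rewrite /Defs.outrate mulr_suml -sumrB; apply: eq_bigr => m _; exact: mulrBr.
congr (_ - _).
transitivity (\sum_(m <- trans xi) \sum_(eta <- r)
    if (eta != xi) && (m.1 == eta) then m.2 * f eta else 0).
  rewrite big_mkcond; apply: eq_bigr => m _ /=.
  have [mr|mr] := boolP (m.1 \in r).
    rewrite (bigD1_seq m.1) //= eqxx andbT big1 ?addr0 // => eta.
    by rewrite eq_sym => /negPf ->; rewrite andbF.
  rewrite fr // mulr0 if_same big1_seq // => eta /andP[_ er].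
  by case: ifP => // /andP[_ /eqP e]; rewrite e er in mr.
rewrite exchange_big [RHS]big_mkcond; apply: eq_bigr => eta _ /=.
case: ifP => _ /=; last by rewrite big1.
by rewrite -big_mkcond /= mulr_suml.
Qed.

Variable mu : Conf N -> R.
Hypothesis mu_stat : stationary s eps gam rL0 rL1 rR0 rR1 mu.

Lemma mu_ge0 eta : 0 <= mu eta. Proof. by case: mu_stat. Qed.

Lemma qrate_eq0 xi eta : (forall m, m \in trans xi -> m.1 = eta -> m.2 = 0) -> qrate xi eta = 0.
Proof.
move=> h; rewrite /Defs.qrate big_seq_cond big1 // => m /andP[mt /eqP me]; exact: h.
Qed.

(** A move of nonzero rate changes the particle number by at most one, so all sources of [eta] lie
    in [upto N n.+1]. At an inadmissible [eta] both sides vanish. *)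
Lemma balance n eta : (tot eta <= n)%N ->
  \sum_(xi <- upto N n.+1 | xi != eta) mu xi * qrate xi eta = mu eta * outrate eta.
Proof.
case: mu_stat => mu0 muN _ bal eta_n.
have [aeta|naeta] := boolP (adm eta); last first.
  rewrite (muN eta) // mul0r big1 // => xi _.
  have [axi|naxi] := boolP (adm xi); last by rewrite muN // mul0r.
  rewrite qrate_eq0 ?mulr0 // => m mt me.
  have [//|/(move_adm axi mt)] := eqVneq m.2 0.
  by rewrite me (negPf naeta).
apply: EFin_inj; rewrite -(bal _ aeta).
rewrite (_ : [set xi | _] = [set xi | adm xi && (xi != eta)]); last first.
  by apply/seteqP; split => xi /= => [[-> /eqP]|/andP[-> /eqP]].
rewrite (@esum_seq _ _ (upto N n.+1)) ?upto_uniq //.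
- congr EFin; rewrite big_mkcond [RHS]big_mkcond; apply: eq_bigr => xi _.
  by case: (boolP (adm xi)) => //= naxi; rewrite muN // mul0r if_same.
- move=> xi /andP[axi _]; rewrite mulr_ge0 // /Defs.qrate big_seq_cond sumr_ge0 // => m.
  by move=> /andP[mt _]; apply: move_rate_ge0 mt.
- move=> xi _; rewrite mem_upto => far.
  rewrite qrate_eq0 ?mulr0 // => m mt me; apply/eqP; apply: contraNT far => m0.
  have [_] := move_tot mt m0; rewrite me; lia.
Qed.

(** After exchanging the finite sums, the coefficient of each [f eta] is the balance equation at
    [eta]. *)
Lemma sum_mu_gen n (f : Conf N -> R) : (forall eta, (n < tot eta)%N -> f eta = 0) ->
  \sum_(xi <- upto N n.+1) mu xi * gen f xi = 0.
Proof.
move=> fn.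
under eq_bigr => xi _.
  rewrite (@genE (upto N n.+1)) ?upto_uniq //; last first.
    by move=> eta; rewrite mem_upto => ?; apply: fn; lia.
  rewrite mulrBr mulr_sumr; over.
rewrite sumrB; apply/eqP; rewrite subr_eq0; apply/eqP.
under eq_bigr do rewrite big_mkcond; rewrite exchange_big /=.
apply: eq_bigr => eta _; rewrite -big_mkcond /=.
under eq_bigl do rewrite eq_sym.
under eq_bigr do rewrite mulrA.
rewrite -mulr_suml; have [le|lt] := leqP (tot eta) n; last by rewrite fn // !mulr0.
by rewrite balance // mulrA.
Qed.

(** * Drift of linear observables *)

Lemma hop_lin (w : nat -> bool -> R) xi k l r c :
  r * (xi k)%:R * c * (lin w (addp (subp xi k) l) - lin w xi) =
  r * (xi k)%:R * c * (w l.1 l.2 - w k.1 k.2).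
Proof.
(* At an empty site the truncated subtraction in [subp] removes nothing, but the rate is 0 there. *)
have [->|pos] := posnP (xi k); first by rewrite mulr0 !mul0r.
by rewrite lin_addp lin_subp //; ring.
Qed.

Lemma rem_lin (w : nat -> bool -> R) xi k c :
  (xi k)%:R * c * (lin w (subp xi k) - lin w xi) = - ((xi k)%:R * c * w k.1 k.2).
Proof.
have [->|pos] := posnP (xi k); first by rewrite !mul0r oppr0.
by rewrite lin_subp //; ring.
Qed.

(* The quadratic terms of the rates cancel between opposite moves. *)
Lemma gen_lin (w : nat -> bool -> R) xi :
  gen (lin w) xi = \sum_(x : 'I_N) \sum_b (w x b * inflow x b + (xi (x, b))%:R * kappa w x b).
Proof.
pose e (x : 'I_N) (b : bool) : R := (xi (x, b))%:R.
pose bulk (b : bool) := \sum_(x : 'I_N) e x b * lap N (w^~ b) x.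
have bulkE (b : bool) : eps ^+ b * bulk b = \sum_(p <- nnpairs N)
   ((jumpR s eps xi p b).2 * (lin w (jumpR s eps xi p b).1 - lin w xi)
   + (jumpL s eps xi p b).2 * (lin w (jumpL s eps xi p b).1 - lin w xi)).
  rewrite /bulk -sum_by_parts -sum_nnpairs mulr_sumr; apply: eq_bigr => p _.
  by rewrite !hop_lin /= -/(e p.1 b) -/(e p.2 b); ring.
(* Creation minus removal: [rho * (1 + sg * e) - e * (1 + sg * rho) = rho - e], for either
   reservoir. *)
have bdry (P : pred 'I_N) (rho : R) (b : bool) : \sum_(x <- [seq x <- enum 'I_N | P x])
      ((xi (x, b))%:R * (1 + sg * rho) * (lin w (subp xi (x, b)) - lin w xi)
      + rho * (1 + sg * (xi (x, b))%:R) * (lin w (addp xi (x, b)) - lin w xi)) =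
    \sum_(x : 'I_N) (P x)%:R * (rho - e x b) * w x b.
  rewrite big_filter big_enum_cond big_mkcond /=; apply: eq_bigr => x _.
  case: ifP => _; last by rewrite !mul0r.
  by rewrite rem_lin lin_addp /= -/(e x b); ring.
have layE T (r : seq T) (F : T -> bool -> R) : \sum_(i <- r) \sum_(b <- layers) F i b =
    \sum_(i <- r) F i false + \sum_(i <- r) F i true.
  by rewrite -big_split; apply: eq_bigr => i _; rewrite !big_cons big_nil addr0.
have sw : \sum_x \sum_(b <- layers)
     (switch s gam xi x b).2 * (lin w (switch s gam xi x b).1 - lin w xi) =
   \sum_(x : 'I_N) gam * (e x false - e x true) * (w x true - w x false).
  apply: eq_bigr => x _; rewrite !big_cons big_nil !hop_lin /=.
  by rewrite -/(e x false) -/(e x true); ring.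
transitivity (eps ^+ false * bulk false + eps ^+ true * bulk true
   + \sum_(x : 'I_N) gam * (e x false - e x true) * (w x true - w x false)
   + \sum_(x : 'I_N) ((val x == 0%N)%:R * (rhoL false - e x false) * w x false)
   + \sum_(x : 'I_N) ((val x == 0%N)%:R * (rhoL true - e x true) * w x true)
   + \sum_(x : 'I_N) ((val x == N.-1)%:R * (rhoR false - e x false) * w x false)
   + \sum_(x : 'I_N) ((val x == N.-1)%:R * (rhoR true - e x true) * w x true)).
  rewrite /gen /Defs.trans !big_cat; rewrite !big_allpairs_dep big_enum; rewrite [X in _ + (_ + (X + _)) = _]sw.
  rewrite !bulkE -!bdry /layers.
  rewrite !layE /leftsites /rightsites !big_split /=; ring.
rewrite /bulk !mulr_sumr -!big_split /=; apply: eq_bigr => x _.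
rewrite big_bool /= /inflow /kappa /= -/(e x false) -/(e x true).
by ring.
Qed.

(** * Lyapunov bound on the mean number of particles *)

Hypothesis N2 : (2 <= N)%N.
Hypothesis eps_le1 : eps <= 1.

Lemma sum_mu_le1 n : \sum_(xi <- upto N n) mu xi <= 1.
Proof.
rewrite -lee_fin; have [_ _ <- _] := mu_stat.
exact: sum_upto_le_esum mu_ge0.
Qed.

(* [X (N + 1 - X)] at the site [X = x + 1]: concave, so its drift dominates the occupation of every site. *)
Definition hump (x : nat) : nat := (x.+1 * (N - x))%N.

Definition humpsum xi : nat := (\sum_(k : 'I_N * bool) hump k.1 * xi k)%N.

Lemma lin_hump xi : lin (fun x _ => (hump x)%:R) xi = (humpsum xi)%:R :> R.
Proof. by rewrite linE /humpsum natr_sum; apply: eq_bigr => k _; rewrite natrM. Qed.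

Lemma tot_le_humpsum xi : (tot xi <= humpsum xi)%N.
Proof.
apply: leq_sum => k _; rewrite leq_pmull // /hump muln_gt0 /= subn_gt0; exact: ltn_ord.
Qed.

Lemma humpsum_le xi : (humpsum xi <= N * N * tot xi)%N.
Proof.
rewrite /humpsum /tot big_distrr /=; apply: leq_sum => k _.
by rewrite leq_mul2r /hump leq_mul ?orbT // leq_subr.
Qed.

(** The switching term vanishes. In the interior the second difference is [-2] and
    [eps <= eps ^+ b]. At an end [lap] equals [N - 2] and killing costs [N], so the total is at most
    [-2]. *)
Lemma kappa_hump x b : (x < N)%N -> kappa (fun x _ => (hump x)%:R) x b <= - (2 * eps).
Proof.
move=> xN; have hE y : (y <= N)%N -> (hump y)%:R = (y%:R + 1) * (N%:R - y%:R) :> R.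
  by move=> yN; rewrite /hump natrM natrB // -natr1.
rewrite /kappa subrr mulr0 addr0 /lap.
have [p0 p1] : eps <= eps ^+ b /\ eps ^+ b <= 1.
  by case: b; rewrite ?expr1 ?expr0.
have N2' : 2 <= N%:R :> R by rewrite (ler_nat _ 2).
case: x xN => [|x] xN.
  have -> : (0 == N.-1)%N = false by apply/eqP; lia.
  rewrite N2 /= !hE ?(ltnW N2) //; have := mulr_ge0 (_ : 0 <= 1 - eps ^+ b) (_ : 0 <= N%:R - 2); rewrite !subr_ge0 => /(_ p1 N2') q.
  by move: p0 p1 N2' q; generalize (eps ^+ b) => p; lra.
rewrite /=; case: ifPn => xN'.
  have -> : (x.+1 == N.-1)%N = false by apply/eqP; lia.
  rewrite !hE ?(ltnW xN) //; last by lia.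
  rewrite -(natr1 x.+1) -(natr1 x) /= mulr0n; move: p0 p1; generalize (eps ^+ b) => p; lra.
have -> : (x.+1 == N.-1)%N by apply/eqP; lia.
rewrite !hE ?(ltnW xN) //; last by lia.
have -> : N%:R = x%:R + 2 :> R by rewrite -[2]/(2%:R) -natrD; congr _%:R; lia.
have x0 : 0 <= x%:R :> R by [].
have := mulr_ge0 (_ : 0 <= 1 - eps ^+ b) x0; rewrite subr_ge0 => /(_ p1).
by rewrite -(natr1 x) /= mulr1n; move: p0 p1; generalize (eps ^+ b) => p; lra.
Qed.

Let hump_in : R := \sum_(x : 'I_N) \sum_b (hump x)%:R * inflow x b.

Lemma hump_in_ge0 : 0 <= hump_in.
Proof.
apply: sumr_ge0 => x _; apply: sumr_ge0 => b _.
by rewrite mulr_ge0 // addr_ge0 ?mulr_ge0 //; case: b.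
Qed.

Lemma gen_hump_le xi :
  gen (lin (fun x _ => (hump x)%:R)) xi <= hump_in - 2 * eps * (tot xi)%:R.
Proof.
have -> : (tot xi)%:R = \sum_(x : 'I_N) \sum_b (xi (x, b))%:R :> R.
  by rewrite /tot natr_sum pair_bigA; apply: eq_bigr => -[].
rewrite gen_lin mulr_sumr -sumrB; apply: ler_sum => x _.
rewrite mulr_sumr -sumrB; apply: ler_sum => b _.
rewrite lerD2l -mulNr mulrC ler_wpM2r //; exact: kappa_hump.
Qed.

(* [min (h, n) - n], where [h] is the hump sum: finitely supported, and a concave function of [h]. *)
Let cap n xi : R := - (n - humpsum xi)%:R.

(** Tangent inequality for a concave function, with slope 1 below [n] and 0 from [n] on, summed
    against nonnegative rates. *)
Lemma gen_cap_le n xi : adm xi ->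
  gen (cap n) xi <= (humpsum xi < n)%N%:R * gen (lin (fun x _ => (hump x)%:R)) xi.
Proof.
move=> axi; rewrite /gen mulr_sumr big_seq [leRHS]big_seq; apply: ler_sum => m mt.
rewrite mulrCA ler_wpM2l ?(move_rate_ge0 axi mt) // !lin_hump /cap.
case: ltnP => h; last first.
  by rewrite mul0r (eqP h) oppr0 subr0 oppr_le0.
rewrite mul1r (natrB _ (ltnW h)).
have [h'|h'] := leqP (humpsum m.1) n; first by rewrite (natrB _ h'); lra.
have -> : (n - humpsum m.1 = 0)%N by apply/eqP; rewrite subn_eq0 ltnW.
have : n%:R <= (humpsum m.1)%:R :> R by rewrite ler_nat ltnW.
by lra.
Qed.

Lemma mean_tot_le n : \sum_(xi <- upto N n) mu xi * (tot xi)%:R <= hump_in / (2 * eps).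
Proof.
(* Large enough that the cap has slope 1 at every configuration with at most [n] particles. *)
pose j := (N * N * n + n).+1.
have jh xi : (tot xi <= n)%N -> (humpsum xi < j)%N.
  by move=> h; have := humpsum_le xi; rewrite /j; nia.
have nj : (n <= j.+1)%N by rewrite /j; lia.
have e0 : 0 < 2 * eps by rewrite mulr_gt0.
rewrite ler_pdivlMr // mulrC (sum_upto_le _ nj).
have z : \sum_(xi <- upto N j.+1) mu xi * gen (cap j) xi = 0.
  apply: sum_mu_gen => xi jxi; rewrite /cap.
  have := tot_le_humpsum xi => ?; have -> : (j - humpsum xi = 0)%N by lia.
  by rewrite oppr0.
(* Beyond [n] particles the negative part of the drift is dropped; where the cap is flat,
   [hump_in >= 0] is enough. *)
have le xi : mu xi * gen (cap j) xi <=
    hump_in * mu xi - 2 * eps * (if (tot xi <= n)%N then mu xi * (tot xi)%:R else 0).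
  have [axi|naxi] := boolP (adm xi); last first.
    by have [_ -> //] := mu_stat; rewrite !mul0r if_same !mulr0 subrr.
  have -> : hump_in * mu xi - 2 * eps * (if (tot xi <= n)%N then mu xi * (tot xi)%:R else 0) =
      mu xi * (hump_in - 2 * eps * (if (tot xi <= n)%N then (tot xi)%:R else 0)).
    by case: ifP => _; ring.
  rewrite ler_wpM2l ?mu_ge0 // (le_trans (gen_cap_le _ axi)) //.
  have g := gen_hump_le xi; have c := hump_in_ge0.
  case: ifPn => [/jh ->|_]; first by rewrite mul1r.
  case: ltnP => _; rewrite ?mul1r ?mul0r mulr0 subr0 //.
  by apply: le_trans g _; rewrite gerBl mulr_ge0 // ltW.
have := ler_sum _ (fun xi _ => le xi) : 
  \sum_(xi <- upto N j.+1) _ <= \sum_(xi <- upto N j.+1) _.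
rewrite z sumrB -!mulr_sumr -big_mkcond /= subr_ge0 => /le_trans; apply.
by rewrite ler_piMr ?hump_in_ge0 // sum_mu_le1.
Qed.

(** * Cut-off linear observables and the vanishing of the mean drift *)

Lemma size_trans : exists n, forall xi, size (trans xi) = n.
Proof. by eexists => xi; rewrite /Defs.trans !size_cat !size_allpairs. Qed.

Let wnorm (w : nat -> bool -> R) : R := \sum_(k : 'I_N * bool) `|w k.1 k.2|.

Lemma lin_le w xi : `|lin w xi| <= wnorm w * (tot xi)%:R.
Proof.
rewrite linE /wnorm mulr_suml (le_trans (ler_norm_sum _ _ _)) //.
apply: ler_sum => k _; rewrite normrM normr_nat ler_wpM2l //.
by rewrite ler_nat conf_le_tot.
Qed.

Let cutlin w j xi : R := if (tot xi <= j)%N then lin w xi else 0.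

(** The two terms differ only if the move crosses the level [j]: a creation at [j] particles or a
    removal at [j + 1]. The rate and the value of [lin w] are then both at most linear in the
    particle number. *)
Lemma cutlin_move w j xi m : adm xi -> m \in trans xi ->
  `|m.2 * (cutlin w j m.1 - cutlin w j xi)
    - (if (tot xi <= j)%N then m.2 * (lin w m.1 - lin w xi) else 0)| <=
  (if (j <= tot xi)%N then (1 + rsum) * wnorm w * (1 + (tot xi)%:R) ^+ 2 else 0).
Proof.
move=> axi mt; set t : R := (tot xi)%:R.
have w0 : 0 <= wnorm w by exact: sumr_ge0.
have r0 : 0 <= 1 + rsum by rewrite !addr_ge0.
have t0 : 0 <= t by [].
have B0 : 0 <= (if (j <= tot xi)%N then (1 + rsum) * wnorm w * (1 + t) ^+ 2 else 0).
  by case: ifP => // _; rewrite !mulr_ge0 // addr_ge0.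
have [->|m0] := eqVneq m.2 0; first by rewrite !mul0r if_same subrr normr0.
have [mle1 mle2] := move_tot mt m0.
have [m0'|e|mle] := move_bulk_or_linear mt; first by rewrite m0' eqxx in m0.
  by rewrite /cutlin e; case: ifP; rewrite ?subrr ?mulr0 ?subrr normr0.
have mlin : `|m.2 * lin w m.1| <= (1 + rsum) * wnorm w * (1 + t) ^+ 2.
  rewrite normrM (ger0_norm (move_rate_ge0 axi mt)).
  have -> : (1 + rsum) * wnorm w * (1 + t) ^+ 2 = (1 + rsum) * (1 + t) * (wnorm w * (1 + t)) by ring.
  apply: ler_pM => //; first exact: move_rate_ge0 mt.
  by rewrite (le_trans (lin_le _ _)) // ler_wpM2l // addrC natr1 ler_nat.
rewrite {1 2}/cutlin; case: (leqP (tot xi) j) => xij.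
  case: (leqP (tot m.1) j) => mj; first by rewrite subrr normr0.
  have -> : (j <= tot xi)%N := leq_trans mj mle1.
  by rewrite (_ : _ - _ = - (m.2 * lin w m.1)) ?normrN //; ring.
rewrite !subr0; case: (leqP (tot m.1) j) => mj; last by rewrite mulr0 normr0.
by rewrite ifT // ltnW.
Qed.

(** The cut observable has mean drift 0; subtracting it leaves the flux through level [j], carried
    by the shells with [j] and [j + 1] particles. [K] contains the number of moves, the same for all
    configurations. *)
Lemma flux_le w : exists2 K, 0 <= K & forall j,
  `|\sum_(xi <- upto N j) mu xi * gen (lin w) xi| <=
  K * \sum_(xi <- upto N j.+1 | (j <= tot xi)%N) mu xi * (1 + (tot xi)%:R) ^+ 2.
Proof.
have [n nE] := size_trans.
have w0 : 0 <= wnorm w by exact: sumr_ge0.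
have r0 : 0 <= 1 + rsum by rewrite !addr_ge0.
exists (n%:R * ((1 + rsum) * wnorm w)); first by rewrite !mulr_ge0.
move=> j; rewrite (sum_upto_le _ (leqnSn j)) big_mkcond /=.
have z : \sum_(xi <- upto N j.+1) mu xi * gen (cutlin w j) xi = 0.
  by apply: sum_mu_gen => xi h; rewrite /cutlin leqNgt h.
rewrite -normrN -[X in `|X|]add0r -{1}z -sumrB (le_trans (ler_norm_sum _ _ _)) //.
rewrite mulr_sumr [leRHS]big_mkcond /=; apply: ler_sum => xi _.
have [axi|naxi] := boolP (adm xi); last first.
  by have [_ -> //] := mu_stat; rewrite !mul0r mulr0 !if_same subrr normr0.
have -> : mu xi * gen (cutlin w j) xi - (if (tot xi <= j)%N then mu xi * gen (lin w) xi else 0) =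
   mu xi * (gen (cutlin w j) xi - (if (tot xi <= j)%N then gen (lin w) xi else 0)).
  by case: ifP => _; ring.
rewrite normrM (ger0_norm (mu_ge0 xi)).
have -> : (if (j <= tot xi)%N then n%:R * ((1 + rsum) * wnorm w) * (mu xi * (1 + (tot xi)%:R) ^+ 2) else 0) =
  mu xi * (n%:R * (if (j <= tot xi)%N then (1 + rsum) * wnorm w * (1 + (tot xi)%:R) ^+ 2 else 0)).
  by case: ifP => _; ring.
rewrite ler_wpM2l ?mu_ge0 // -(nE xi) /gen.
have -> : (if (tot xi <= j)%N then \sum_(m <- trans xi) m.2 * (lin w m.1 - lin w xi) else 0) =
   \sum_(m <- trans xi) (if (tot xi <= j)%N then m.2 * (lin w m.1 - lin w xi) else 0).
  by case: ifP => // _; rewrite big1.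
rewrite -sumrB (le_trans (ler_norm_sum _ _ _)) //.
rewrite big_seq (le_trans (ler_sum _ (fun m => cutlin_move w j axi))) //.
by rewrite -big_seq big_const_seq count_predT iter_addr_0 mulr_natl.
Qed.

Let mass n : R := \sum_(xi <- upto N n) mu xi * (1 + (tot xi)%:R).

Lemma mass_le n : mass n <= 1 + hump_in / (2 * eps).
Proof.
rewrite /mass; under eq_bigr do rewrite mulrDr mulr1.
by rewrite big_split lerD ?sum_mu_le1 ?mean_tot_le.
Qed.

Lemma mass_ge0 n : 0 <= mass n.
Proof. by apply: sumr_ge0 => xi _; rewrite mulr_ge0 ?mu_ge0 ?addr_ge0. Qed.

Lemma mass_shell i :
  \sum_(xi <- upto N i.+2 | (i.+1 <= tot xi)%N) mu xi * (1 + (tot xi)%:R) = mass i.+2 - mass i.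
Proof.
have le : (i <= i.+2)%N by rewrite ltnW.
have := sum_upto_le (fun xi => mu xi * (1 + (tot xi)%:R)) le; rewrite -/(mass i) => ->.
rewrite /mass [X in _ = X - _](bigID (fun xi => (tot xi <= i)%N)) /= [X in _ = X - _]addrC addrK.
by apply: eq_bigl => xi; rewrite ltnNge.
Qed.

(** Consecutive pairs of shells overlap, so the telescoping has step two. *)
Lemma sum_mass_shell n : \sum_(i < n) (mass i.+2 - mass i) = mass n.+1 + mass n - mass 1 - mass 0.
Proof.
by elim: n => [|n IHn]; rewrite ?big_ord0 ?big_ord_recr /= ?IHn; ring.
Qed.

Lemma mean_gen_lin_lim w (l : R) :
  (fun n => \sum_(xi <- upto N n) mu xi * gen (lin w) xi) @ \oo --> l -> l = 0.
Proof.
set u := (fun n : nat => _) => ul; have [K K0 flux] := flux_le w.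
(* On the shells [i + 1] and [i + 2] one factor [1 + tot xi] is at most [i + 3 <= 3 * (i + 1)],
   whence the 3; the overlap of the shells gives the 2. *)
apply: (@lim_eq0_of_harmonic _ (fun n => u n.+1) (fun i => 3 * K * (mass i.+2 - mass i))
          l (3 * K * (2 * (1 + hump_in / (2 * eps))))).
- by rewrite (cvg_shiftS u).
- move=> i; apply: (le_trans (flux i.+1)); rewrite -mass_shell.
  rewrite (_ : i.+1%:R * _ = K * (3 * i.+1%:R *
      \sum_(xi <- upto N i.+2 | (i.+1 <= tot xi)%N) mu xi * (1 + (tot xi)%:R))); last by ring.
  rewrite ler_wpM2l // mulr_sumr big_seq_cond [leRHS]big_seq_cond; apply: ler_sum => xi.
  rewrite mem_upto => /andP[xi_le _].
  rewrite [leRHS]mulrCA ler_wpM2l ?mu_ge0 // expr2 ler_wpM2r ?addr_ge0 //.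
  rewrite nat1r -natrM ler_nat (leq_trans (_ : _ <= i.+3)%N) //; clear -i; lia.
- move=> n; rewrite -mulr_sumr sum_mass_shell ler_wpM2l ?mulr_ge0 //.
  have := mass_le n; have := mass_le n.+1; have := mass_ge0 0; have := mass_ge0 1; lra.
Qed.

(** * The equations for the stationary means *)

Lemma mean_gen_lin w n : \sum_(xi <- upto N n) mu xi * gen (lin w) xi =
  \sum_(x : 'I_N) \sum_b (w x b * inflow x b * \sum_(xi <- upto N n) mu xi
    + kappa w x b * \sum_(xi <- upto N n) mu xi * (xi (x, b))%:R).
Proof.
under eq_bigr do rewrite gen_lin mulr_sumr.
rewrite exchange_big; apply: eq_bigr => x _; under eq_bigr do rewrite mulr_sumr.
rewrite exchange_big; apply: eq_bigr => b _.
rewrite !mulr_sumr -big_split /=; apply: eq_bigr => xi _; ring.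
Qed.

Lemma mean_cvg (k : 'I_N * bool) : exists T : R,
  (fun n => \sum_(xi <- upto N n) mu xi * (xi k)%:R) @ \oo --> T /\ theta mu k.2 k.1 = T%:E.
Proof.
have [|n|T cT eT] := @sum_upto_cvg N R (fun xi => mu xi * (xi k)%:R) (hump_in / (2 * eps)).
- by move=> xi; rewrite mulr_ge0 ?mu_ge0.
- apply: le_trans (mean_tot_le n); apply: ler_sum => xi _.
  by rewrite ler_wpM2l ?mu_ge0 // ler_nat conf_le_tot.
by exists T; split => //; case: (k) eT => x b.
Qed.

Lemma sum_mu_cvg : (fun n => \sum_(xi <- upto N n) mu xi) @ \oo --> (1 : R).
Proof.
have [T cT eT] := sum_upto_cvg mu_ge0 sum_mu_le1.
by have [_ _] := mu_stat; rewrite eT => -[] <-.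
Qed.

(** The partial mean drift of [lin w] is linear in the partial means, so it converges to the left
    side of the equation; such a limit is 0. *)
Lemma stationary_mean : exists T : nat -> bool -> R,
  (forall (x : 'I_N) b, theta mu b x = (T x b)%:E) /\
  forall w : nat -> bool -> R, \sum_(x : 'I_N) \sum_b (w x b * inflow x b + kappa w x b * T x b) = 0.
Proof.
have [T hT] := choice mean_cvg.
(* The means are extended by 0 off the segment, since [kappa] acts on functions of a natural
   number. *)
pose T' (n : nat) b := if insub n is Some i then T (i, b) else 0.
have T'E (x : 'I_N) b : T' x b = T (x, b) by rewrite /T' valK.
exists T'; split=> [x b|w]; first by rewrite T'E; have [_] := hT (x, b).
apply: (@mean_gen_lin_lim w).
rewrite (_ : (fun n => _) = (fun n => \sum_(x : 'I_N) \sum_b (w x b * inflow x b * \sum_(xi <- upto N n) mu xi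
    + kappa w x b * \sum_(xi <- upto N n) mu xi * (xi (x, b))%:R))); last first.
  by apply/funext => n; exact: mean_gen_lin.
apply: cvg_big => [|x _]; first exact: add_continuous.
apply: cvg_big => [|b _]; first exact: add_continuous.
rewrite T'E; apply: cvgD; last by apply: cvgMl_tmp; have [] := hT (x, b).
by rewrite -[X in _ --> X]mulr1; apply: cvgMl_tmp; exact: sum_mu_cvg.
Qed.

End Generator.

Theorem mainTheorem7 (R : realType) (s : int) (N : nat) (eps gam : R)
    (rL0 rL1 rR0 rR1 : R) (mu : Conf N -> R) :
  [|| s == -1, s == 0 | s == 1] ->
  (2 <= N)%N ->
  0 < eps -> eps <= 1 -> 0 < gam ->
  0 <= rL0 -> 0 <= rL1 -> 0 <= rR0 -> 0 <= rR1 ->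
  (s = -1 -> [/\ rL0 <= 1, rL1 <= 1, rR0 <= 1 & rR1 <= 1]) ->
  stationary s eps gam rL0 rL1 rR0 rR1 mu ->
  forall x : 'I_N,
    let X := (val x).+1 in
    let c k := cdot N eps gam rL0 rL1 rR0 rR1 k in
    let a1 := alpha1 eps gam in
    let a2 := alpha2 eps gam in
    theta mu false x =
      (c 1%N * X%:R + c 2%N + eps * c 3%N * a1 ^+ X + eps * c 4%N * a2 ^+ X)%:E /\
    theta mu true x =
      (c 1%N * X%:R + c 2%N - c 3%N * a1 ^+ X - c 4%N * a2 ^+ X)%:E.
Proof.
move=> s_val N2 eps0 eps1 gam0 L0 L1 R0 R1 r1 mu_stat x /=.
have [T [thetaE hT]] := stationary_mean s_val eps0 gam0 L0 L1 R0 R1 r1 mu_stat N2 eps1.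
have TE b := mean_profile eps0 gam0 N2 hT b (ltn_ord x).
(* Matrix indices start at 0, those of [cdot] at 1. *)
have cE k : (invmx (Meps N eps gam) *m \col_j rhovec rL0 rL1 rR0 rR1 j) (inord k) 0
    = cdot N eps gam rL0 rL1 rR0 rR1 k.+1.
  by rewrite mxE; apply: eq_bigr => j _; rewrite mxE.
rewrite !thetaE !TE /profile !cE; split; congr EFin; ring.
Qed.
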